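(* Let $(G,\omega)$ be a connected weighted graph with $n$ vertices $v_1,\dots,v_n$ and weight function $\omega:E(G)\to\mathbb R$, and let $\Delta_{(G,\omega)}$ be its graph Laplacian. Fix a potential $\delta:V(G)\to\mathbb R$, $\delta_i=\delta(v_i)$, with associated diagonal matrix $D=\operatorname{diag}(\delta_1,\dots,\delta_n)$. Then $$ \det(\Delta_{(G,\omega)}+D)=\sum_{T\in\mathsf{Sp}(G)}\ \sum_{\ell=1}^n\ \sum_{1\le i_1<\cdots<i_\ell\le n}\ \sum_{S\in\mathscr E(T;v_{i_1},\dots,v_{i_\ell})}\frac{\delta_{i_1}\cdots\delta_{i_\ell}}{m(T,S)}\prod_{e\in E(T)\setminus S}\omega(e). $$
   Context: Graphs are undirected and simple (at most one edge between two distinct vertices, no loops). The weighted graph Laplacian is the $n\times n$ symmetric matrix with $(i,j)$ entry $-\omega(ij)$ if $(ij)\in E(G)$, diagonal entries $\mu_i=\sum_{(ij)\in E(G)}\omega(ij)$, and $0$ otherwise. $\mathsf{Sp}(G)$ is the set of spanning trees of $G$ (connected trees $T\subset G$ with $V(T)=V(G)$). For a tree $T$ and distinct vertices $w_1,\dots,w_\ell$ of $T$, $\mathscr E(T;w_1,\dots,w_\ell)$ is the set of collections $S$ of $\ell-1$ edges of $T$ such that each of the $\ell$ connected components of $T\setminus S$ (edges in $S$ deleted, all vertices kept) contains exactly one of the $w_j$. For $T\in\mathsf{Sp}(G)$ and $S\in\mathscr E(T;w_1,\dots,w_\ell)$, the multiplicity is $$m(T,S)=\#\{(T',S')\mid T'\in\mathsf{Sp}(G),\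 S'\in\mathscr E(T';w_1,\dots,w_\ell),\ T'\setminus S'=T\setminus S\}.$$ Empty products equal $1$. *)

(* Defs.v *)
From HB Require Import structures.
From mathcomp Require Import all_boot all_order all_algebra.

Set Implicit Arguments.
Unset Strict Implicit.
Unset Printing Implicit Defensive.

Import GRing.Theory.

(* A graph on the finite vertex set V is given by its edge set, an edge being  *)
(* an unordered pair of vertices; the spanning subgraphs of such a graph are   *)
(* the subsets of its edge set (all vertices are kept).                        *)
Section Graphs.
Variable V : finType.
Implicit Types (E T S : {set {set V}}) (w : seq V).

Definition simple_graph E : bool := [forall e in E, #|e| == 2].

Definition adj E : rel V := fun x y => [set x; y] \in E.

(* The empty graph is not connected. *)
Definition connected_graph E : bool :=
  (0 < #|V|) && [forall x, forall y, connect (adj E) x y].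

(* A cycle is given by its sequence of at least three pairwise distinct        *)
(* vertices, hence by at most #|V| of them; see acyclic_graphP.                *)
Definition acyclic_graph E : bool :=
  [forall k : 'I_#|V|.+1, forall c : k.-tuple V,
     (2 < k) ==> ~~ ucycleb (adj E) c].

Lemma acyclic_graphP E :
  reflect (forall c : seq V, 2 < size c -> ~ ucycle (adj E) c)
          (acyclic_graph E).
Proof.
apply: (iffP idP) => [acE c c_gt2 ucE | acE].
  have szc : size c < #|V|.+1.
    by case/andP: ucE => _ /card_uniqP <-; rewrite ltnS max_card.
  move/forallP/(_ (Ordinal szc))/forallP/(_ (in_tuple c)): acE.
  by move/implyP/(_ c_gt2)/negP.
apply/forallP => k; apply/forallP => c; apply/implyP => k_gt2.
by apply/negP; apply: acE; rewrite size_tuple.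
Qed.

Definition tree E : bool := connected_graph E && acyclic_graph E.

Definition spanning_trees E : {set {set {set V}}} :=
  [set T : {set {set V}} | (T \subset E) && tree T].

Definition components E : {set {set V}} :=
  equivalence_partition (connect (adj E)) [set: V].

(* The list w stands for w_1, ..., w_l; its entries are meant to be distinct.  *)
Definition cuts T w : {set {set {set V}}} :=
  [set S : {set {set V}} | [&& S \subset T, #|S| == (size w).-1
     & [forall C in components (T :\: S), count (mem C) w == 1]]].

(* The multiplicity depends on the ambient graph E and on w, besides T and S.  *)
Definition multiplicity E w T S : nat :=
  #|[set p : {set {set V}} * {set {set V}} |
      [&& p.1 \in spanning_trees E, p.2 \in cuts p.1 w
        & p.1 :\: p.2 == T :\: S]]|.

End Graphs.

Local Open Scope ring_scope.

(* Only the values of omega on the elements of E are used. *)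
Definition laplacian (R : pzRingType) n (E : {set {set 'I_n}})
    (omega : {set 'I_n} -> R) : 'M[R]_n :=
  \matrix_(i, j)
    if i == j then \sum_(k | adj E i k) omega [set i; k]
    else if adj E i j then - omega [set i; j] else 0.

(* Main.v *)
Require Import Defs.
From HB Require Import structures.
From mathcomp Require Import all_boot all_order all_algebra.
From mathcomp Require Import fingroup perm.

Set Implicit Arguments.
Unset Strict Implicit.
Unset Printing Implicit Defensive.

(** Row i of the matrix Delta + D is a linear combination of elementary rows:
    e_i with coefficient delta_i, and e_i - e_k with coefficient omega(ik) for
    each neighbour k of i.  By multilinearity the determinant is a sum over the
    maps f that choose, for each vertex, either nothing (the vertex is a root)
    or a neighbour (its parent), of the product of the chosen coefficients
    times the determinant of the matrix of chosen elementary rows.  That last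
    determinant is 1 when iterating f always ends at a root, and 0 otherwise
    (det_parent_mx): in the first case the matrix is triangular for the order
    by depth, in the second the indicator of the vertices that never
    reach a root is in its kernel.

    Maps f of the first kind are the same thing as forests F in G with one
    marked vertex in each component: parent_edges f is such a forest, with
    marked vertices the roots of f (parent_edges_rooted_forest), f can be
    recovered from both (parent_edges_inj), and every rooted forest arises in
    this way (rooted_forest_parent_map).  Hence det (Delta + D) is the sum over
    the vertex sets W of the product of delta over W, times the sum of the
    weights of the forests rooted at W (det_laplacian_forests).

    On the other side, T minus S is a forest rooted at w_1, ..., w_l for each
    spanning tree T and each cut S, so the right-hand side can be
    summed first over the pairs (T, S) with a given difference F.  The division
    by m(T, S) turns each such partial sum into one copy of the weight of F,
    provided there is at least one pair: this holds because G is connected,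
    so that F extends to a spanning tree (spanning_tree_extension), and because
    the numbers of edges of a tree and of a forest leave exactly l - 1 edges to
    cut (sum_trees_cuts). *)

Import GRing.Theory.
Local Open Scope ring_scope.

(** * Parent maps and their graphs *)

Section ParentMaps.
Variable V : finType.
Implicit Types f g : {ffun V -> option V}.
Local Open Scope nat_scope.

Definition root_set f : {set V} := [set x | f x == None].

Definition parent_edges f : {set {set V}} :=
  [set [set x; odflt x (f x)] | x in ~: root_set f].

(** The value [None] plays the role of an absorbing state: a vertex reaches a
    root when its orbit under this total map contains [None]. *)
Definition step f : option V -> option V := obind f.

Definition grounded f : bool := [forall x, fconnect (step f) (Some x) None].

Definition depth f x : nat := findex (step f) (Some x) None.

Lemma fconnect_step f x :
  fconnect (step f) (Some x) None = fconnect (step f) (f x) None.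
Proof.
apply/idP/idP => [/iter_findex | ].
  case: findex => [|k] //; rewrite iterSr /= => <-; exact: fconnect_iter.
by apply: connect_trans; apply: fconnect1.
Qed.

Lemma mem_root_set f x : (x \in root_set f) = (f x == None).
Proof. by rewrite inE. Qed.

Lemma depthS f x y : grounded f -> f x = Some y -> depth f x = (depth f y).+1.
Proof.
by move=> /forallP/(_ x) fx fxy; rewrite /depth fconnect_findex //= fxy.
Qed.

Lemma depth_lt f x y : grounded f -> f x = Some y -> depth f y < depth f x.
Proof. by move=> gf fx; rewrite (depthS gf fx). Qed.

Lemma parent_asym f x y : grounded f -> f x = Some y -> f y <> Some x.
Proof.
by move=> gf /(depth_lt gf) yx /(depth_lt gf) xy; rewrite ltnNge ltnW in xy.
Qed.

(** Any function that decreases from child to parent certifies that [f] is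
    grounded; conversely the depth is such a function. *)
Lemma groundedP f (d : V -> nat) :
  (forall x y, f x = Some y -> d y < d x) -> grounded f.
Proof.
move=> dlt; apply/forallP => x.
have [k] := ubnP (d x); elim: k x => // k IHk x dk.
rewrite fconnect_step; case fx: (f x) => [y|]; last exact: connect0.
by apply: IHk; apply: leq_trans (dlt _ _ fx) _.
Qed.

Lemma parent_edge f x y : f x = Some y -> [set x; y] \in parent_edges f.
Proof.
move=> fx; apply/imsetP; exists x; last by rewrite fx.
by rewrite in_setC mem_root_set fx.
Qed.

Lemma set2_inj (x y x' y' : V) : [set x; y] = [set x'; y'] ->
  x = x' /\ y = y' \/ x = y' /\ y = x'.
Proof.
move=> e; have ex : x \in [set x'; y'] by rewrite -e set21.
have ey : y \in [set x'; y'] by rewrite -e set22.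
have ex' : x' \in [set x; y] by rewrite e set21.
have ey' : y' \in [set x; y] by rewrite e set22.
case/set2P: ex ey ey' ex' => <-; first by do 2![case/set2P=> ?]; subst; auto.
by case/set2P=> [<-|->]; auto; move=> _ /set2P[]->; auto.
Qed.

Lemma adj_sym (E : {set {set V}}) : symmetric (adj E).
Proof. by move=> x y; rewrite /adj setUC. Qed.

Lemma connect_adj_sym (E : {set {set V}}) : connect_sym (adj E).
Proof. exact/sym_connect_sym/adj_sym. Qed.

Lemma adj_parent_edges f x y :
  reflect (f x = Some y \/ f y = Some x) (adj (parent_edges f) x y).
Proof.
apply: (iffP idP) => [/imsetP[z] | [] /parent_edge //]; last first.
  by rewrite setUC.
rewrite in_setC mem_root_set; case fz: (f z) => [t|] //= _.
by case/set2_inj=> [[-> ->]|[-> ->]]; [left|right].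
Qed.

(** An edge determines its child end: otherwise its two ends would be each
    other's parent. *)
Lemma parent_edge_inj f : grounded f ->
  {in ~: root_set f &, injective (fun x => [set x; odflt x (f x)])}.
Proof.
move=> gf x y; rewrite !in_setC !mem_root_set.
case fx: (f x) => [x'|] // _; case fy: (f y) => [y'|] //= _ /set2_inj[[]|[]] //.
by move=> xy' yx'; case: (parent_asym gf fx); rewrite yx' fy -xy'.
Qed.

Lemma card_parent_edges f : grounded f -> #|parent_edges f| = #|V| - #|root_set f|.
Proof.
move=> gf; rewrite card_in_imset; last exact: parent_edge_inj.
by rewrite cardsCs setCK.
Qed.

(** At a deepest vertex of a cycle both neighbours would have to be its parent,
    but the neighbours of a vertex in a cycle are distinct. *)
Lemma parent_edges_acyclic f : grounded f -> acyclic_graph (parent_edges f).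
Proof.
move=> gf; apply/acyclic_graphP => -[//|x0 c] c_gt2 /andP[cyc unc].
have x0c : x0 \in x0 :: c by rewrite mem_head.
case: (arg_maxnP (P := mem (x0 :: c)) (depth f) x0c) => x xc xmax.
have nbr y : y \in x0 :: c -> adj (parent_edges f) x y -> f x = Some y.
  move=> yc /adj_parent_edges[] // /(depthS gf) dy.
  by have := xmax _ yc; rewrite dy /= ltnn.
have [i p rp] := rot_to xc.
rewrite -(rot_cycle i) rp in cyc; rewrite -(rot_uniq i) rp in unc.
rewrite -(size_rot i) rp in c_gt2.
have mem_rot_c y : y \in x :: p -> y \in x0 :: c by rewrite -rp mem_rot.
case: p c_gt2 cyc unc mem_rot_c {rp} => [//|y p] c_gt2 /=.
rewrite rcons_path => /and3P[xy _ lx] /and3P[_ yp _] memc.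
have fxy : f x = Some y by apply: nbr xy; apply: memc; rewrite !inE eqxx orbT.
have /nbr : last y p \in x0 :: c by apply: memc; rewrite inE mem_last orbT.
rewrite adj_sym fxy => /(_ lx) [yl].
case: p c_gt2 yp yl {lx memc} => [//|z p] _ yp /= yl.
by rewrite yl mem_last in yp.
Qed.

(** Iterating beyond the root is harmless, as the default value keeps a root in
    place; this matters because the depth of a root is 1, not 0. *)
Definition tree_root f x : V := iter (depth f x) (fun y => odflt y (f y)) x.

Lemma depth_of_root f x : grounded f -> f x = None -> depth f x = 1.
Proof.
move=> /forallP/(_ x) fx fx0; rewrite /depth fconnect_findex //= fx0.
by rewrite findex0.
Qed.

Lemma tree_root_step f x y : grounded f -> f x = Some y -> tree_root f x = tree_root f y.
Proof.
by move=> gf fx; rewrite /tree_root (depthS gf fx) iterSr fx.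
Qed.

Lemma tree_root_id f x : grounded f -> x \in root_set f -> tree_root f x = x.
Proof.
by rewrite mem_root_set => gf /eqP fx; rewrite /tree_root (depth_of_root gf fx) /= fx.
Qed.

(** The root is constant along edges, so each component has only one. *)
Lemma connect_tree_root f x y : grounded f ->
  connect (adj (parent_edges f)) x y -> tree_root f x = tree_root f y.
Proof.
move=> gf /connectP[p]; elim: p x => [x _ -> //|z p IHp x /= /andP[xz pz] ly].
rewrite -(IHp z) //; case/adj_parent_edges: xz => /(tree_root_step gf) //.
Qed.

Lemma grounded_reach f x : grounded f ->
  exists2 r, r \in root_set f & connect (adj (parent_edges f)) x r.
Proof.
move=> gf; have [k] := ubnP (depth f x); elim: k x => // k IHk x dk.
case fx: (f x) => [y|]; last by exists x => //; rewrite mem_root_set fx.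
have [|r rr yr] := IHk y; first by rewrite -ltnS -(depthS gf fx).
exists r => //; apply: connect_trans yr; apply: connect1.
by apply/adj_parent_edges; left.
Qed.

(** By induction on the depth of [x]: if the edge from [x] to its [f]-parent [y]
    were the edge from [y] to its [g]-parent, then [x] would also be the
    [f]-parent of [y], since [f] and [g] agree on [y]. *)
Lemma parent_edges_inj f g : grounded f -> grounded g ->
  root_set f = root_set g -> parent_edges f = parent_edges g -> f = g.
Proof.
move=> gf gg rfg efg; apply/ffunP => x.
have [k] := ubnP (depth f x); elim: k x => // k IHk x dk.
case fx: (f x) => [y|]; last first.
  by apply/esym/eqP; rewrite -mem_root_set -rfg mem_root_set fx.
have : adj (parent_edges g) x y by rewrite -efg; apply/adj_parent_edges; left.
case/adj_parent_edges => // gy.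
have fy : f y = Some x by rewrite IHk // -ltnS -(depthS gf fx).
by case: (parent_asym gf fx).
Qed.

End ParentMaps.

(** * Rooted forests as parent maps *)

Section RootedForests.
Variable V : finType.
Implicit Types (f : {ffun V -> option V}) (E F X T S : {set {set V}}) (W : {set V}).
Local Open Scope nat_scope.

Definition rooted_forest F W : bool :=
  acyclic_graph F && [forall x, #|[set r in W | connect (adj F) x r]| == 1].

Lemma rooted_forestP F W :
  reflect [/\ acyclic_graph F,
              forall x, exists2 r, r \in W & connect (adj F) x r
            & {in W &, forall r s, connect (adj F) r s -> r = s}]
          (rooted_forest F W).
Proof.
apply: (iffP andP) => -[acF].
  move/forallP => F1; split=> // [x | r s rW sW rs].
    by have /cards1P[r /setP/(_ r)] := F1 x; rewrite !inE eqxx => /andP[]; exists r.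
  have /cards1P[t /setP eqt] := F1 r.
  by move: (eqt r) (eqt s); rewrite !inE rW sW rs connect0 => /esym/eqP-> /esym/eqP->.
move=> reach sep; split=> //; apply/forallP => x; have [r rW xr] := reach x.
apply/cards1P; exists r; apply/setP => s; rewrite !inE.
apply/andP/eqP => [[sW xs] | -> //]; apply: sep => //.
by apply: connect_trans xr; rewrite connect_adj_sym.
Qed.

Lemma sub_adj F X : F \subset X -> subrel (adj F) (adj X).
Proof. by move=> /subsetP FX x y; apply: FX. Qed.

Lemma sub_connect F X : F \subset X -> subrel (connect (adj F)) (connect (adj X)).
Proof. by move=> FX; apply: connect_sub => x y /(sub_adj FX); apply: connect1. Qed.

Lemma sub_acyclic F X : F \subset X -> acyclic_graph X -> acyclic_graph F.
Proof.
move=> FX /acyclic_graphP acX; apply/acyclic_graphP => c /acX noc.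
by case/andP => cF uc; apply: noc; rewrite /ucycle uc andbT (sub_cycle (sub_adj FX)).
Qed.

Lemma sub_simple F X : F \subset X -> simple_graph X -> simple_graph F.
Proof.
by move=> /subsetP FX /forall_inP sX; apply/forall_inP => e /FX; apply: sX.
Qed.

Lemma simple_edge E e : simple_graph E -> e \in E ->
  exists x y, x != y /\ e = [set x; y].
Proof. by move=> /forall_inP sE /sE/cards2P[x [y]]; exists x, y. Qed.

Lemma adj_irrefl E x : simple_graph E -> adj E x x = false.
Proof. by move=> /forall_inP sE; apply/negP => /sE; rewrite cards2 eqxx. Qed.

Lemma parent_edges_rooted_forest f :
  grounded f -> rooted_forest (parent_edges f) (root_set f).
Proof.
move=> gf; apply/rooted_forestP; split=> [|x|r s rW sW].
- exact: parent_edges_acyclic.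
- exact: grounded_reach.
by move/(connect_tree_root gf); rewrite !tree_root_id.
Qed.

(** The distance to [W], obtained by growing balls around [W]. *)
Lemma distance_to F W : (forall x, exists2 r, r \in W & connect (adj F) x r) ->
  exists d : V -> nat, forall x, x \notin W -> exists2 y, adj F x y & d y < d x.
Proof.
move=> reach.
pose ball k := iter k (fun B => B :|: [set x | [exists y in B, adj F x y]]) W.
have ball_ex x : exists k, x \in ball k.
  have [r rW /connectP[p pth lp]] := reach x.
  exists (size p); elim: p x pth lp => [x _ /= <- //|y p IHp x /= /andP[xy yp] lp].
  rewrite !inE; apply/orP; right; apply/exists_inP; exists y => //; exact: IHp.
exists (fun x => ex_minn (ball_ex x)) => x xW.
case: ex_minnP => -[|k]; first by rewrite (negbTE xW).
rewrite /= !inE => /orP[xk /(_ _ xk)|/exists_inP[y yk xy] _]; first by rewrite ltnn.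
by exists y => //; case: ex_minnP => m _ /(_ _ yk).
Qed.

(** Each vertex outside [W] picks a neighbour that is closer to [W]. *)
Lemma parent_map_exists F W : (forall x, exists2 r, r \in W & connect (adj F) x r) ->
  exists f, [/\ grounded f, root_set f = W & parent_edges f \subset F].
Proof.
move=> /distance_to[d dP].
pose f := [ffun x => if x \in W then None else [pick y | adj F x y & d y < d x]].
have fP x y : f x = Some y -> adj F x y /\ d y < d x.
  by rewrite ffunE; case: ifP => // _; case: pickP => // z /andP[? ?] [<-].
have rf : root_set f = W.
  apply/setP => x; rewrite mem_root_set ffunE; case: ifPn => // xW.
  by case: pickP => // /= none; case: (dP x xW) => y xy yx; move: (none y); rewrite xy yx.
exists f; split=> //; first by apply: (groundedP (d := d)) => x y /fP[].
apply/subsetP => e /imsetP[x]; rewrite in_setC mem_root_set.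
by case fx: (f x) => [y|] // _ ->; have [] := fP _ _ fx.
Qed.

(** A path in [F] that joins the ends of an edge in [X] but not in [F]
    would close up to a cycle of [X]. *)
Lemma acyclic_edge_eq F X : simple_graph X -> acyclic_graph X -> F \subset X ->
  (forall x y, adj X x y -> connect (adj F) x y) -> F = X.
Proof.
move=> sX /acyclic_graphP acX FX FXc; apply/eqP; rewrite eqEsubset FX.
apply/subsetP => e eX; have [x [y [xy def_e]]] := simple_edge sX eX.
rewrite def_e in eX *; apply/negPn/negP => eF.
have /connectP[p] := FXc x y eX.
case/shortenP => q pq uq _ ly.
(* The path has at least two edges, hence the cycle three vertices: the edge
   from [x] to [y] is not in [F]. *)
apply: (acX (x :: q)).
  case: q pq ly {uq} => [|z [|t q]] //= pq ly; first by rewrite ly eqxx in xy.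
  by case/negP: eF; rewrite ly; case/andP: pq.
apply/andP; split=> //=; rewrite rcons_path -ly adj_sym.
by rewrite (sub_path (sub_adj FX) pq).
Qed.

(** The map of [parent_map_exists] has its edges in [F].  They are all of [F] by
    acyclicity: the ends of an edge of [F] have the same root, since a component
    of [F] has only one vertex in [W], and so they are joined by parent edges. *)
Lemma rooted_forest_parent_map F W : simple_graph F -> rooted_forest F W ->
  exists f, [/\ grounded f, root_set f = W & parent_edges f = F].
Proof.
move=> sF /rooted_forestP[acF reach sep].
have [f [gf rf fF]] := parent_map_exists reach.
exists f; split=> //; apply: acyclic_edge_eq => // x y xy.
have [r rW xr] := grounded_reach x gf; have [s sW ys] := grounded_reach y gf.
apply: (connect_trans xr); rewrite connect_adj_sym.
suff -> : r = s by [].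
apply: sep; rewrite -?rf //.
apply: connect_trans (sub_connect fF ys); apply: connect_trans (connect1 xy).
by rewrite connect_adj_sym; apply: sub_connect xr.
Qed.

(** Every vertex other than a root owns exactly one edge, the one to its parent. *)
Lemma card_rooted_forest F W : simple_graph F -> rooted_forest F W ->
  #|F| = #|V| - #|W|.
Proof.
move=> sF /(rooted_forest_parent_map sF)[f [gf <- <-]]; exact: card_parent_edges.
Qed.

(** The rest of the cycle joins the ends of its first edge. *)
Lemma cycle_edge_bypass X x y z p : ucycle (adj X) [:: x, y, z & p] ->
  connect (adj (X :\ [set x; y])) x y.
Proof.
case/andP=> /= /and3P[_ yz zp] /and3P[xp yp _].
(* No other edge of the cycle contains [x], except the one from the last vertex. *)
have offx a b : a != x -> b != x -> adj X a b -> adj (X :\ [set x; y]) a b.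
  move=> ax bx; rewrite /adj in_setD1 => ->; rewrite andbT; apply/eqP => /set2_inj[][] ? ?;
  by subst; rewrite eqxx in ax bx.
rewrite connect_adj_sym; move: xp yp; rewrite !inE !negb_or.
case/and3P=> xy xz xp /andP[yz' yp].
have zp' : path (adj X) z p && adj X (last z p) x by rewrite -rcons_path.
case/andP: zp' => {}zp lx.
apply: connect_trans (connect1 _) _; first by apply: offx yz; rewrite eq_sym.
apply/connectP; exists (rcons p x); last by rewrite last_rcons.
have lzp : last z p \in z :: p by apply: mem_last.
rewrite rcons_path; apply/andP; split; last first.
  move: lx; rewrite /adj in_setD1 => ->; rewrite andbT; apply/eqP => /set2_inj[[lx'] | [ly _]].
    by move: lzp; rewrite lx' inE (negbTE xz) (negbTE xp).
  by move: lzp; rewrite ly inE (negbTE yz') (negbTE yp).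
elim: p z xz xp zp {yz yz' yp lx lzp} => //= a p IHp z xz.
rewrite inE negb_or => /andP[xa xp] /andP[za ap].
by rewrite offx 1?eq_sym //=; apply: IHp.
Qed.

(** A minimal connected graph between [F] and [E] has no cycle: as [F] is acyclic,
    a cycle would have an edge outside [F], which could be removed. *)
Lemma spanning_tree_extension E F :
  connected_graph E -> F \subset E -> acyclic_graph F ->
  exists2 T, T \in spanning_trees E & F \subset T.
Proof.
move=> /andP[V0 cE] FE acF.
pose P X := (F \subset X) && [forall x, forall y, connect (adj X) x y].
have PE : P E by rewrite /P FE.
have [X /minsetP[/andP[FX cX] minX] XE] := minset_exists PE.
exists X => //; rewrite inE XE /tree /connected_graph V0 cX /=.
apply/acyclic_graphP => c c_gt2 cyc.
case/andP: (cyc) => cX' uc.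
have [x xc xF] : exists2 x, x \in c & ~~ adj F x (next c x).
  apply/exists_inP; rewrite -negb_forall_in; apply/negP => /forall_inP cF.
  by case: (acyclic_graphP F acF c c_gt2); apply/andP; split=> //; apply: cycle_from_next.
have [i q rq] := rot_to xc.
move: cyc; rewrite -(rot_ucycle i) rq; move: xF; rewrite -(next_rot i uc) rq.
rewrite -(size_rot i) rq in c_gt2.
case: q c_gt2 {rq} => [|y [|z q]] //= _; rewrite eqxx => xF cyc.
have xy := cycle_edge_bypass cyc.
have /minX : P (X :\ [set x; y]).
  rewrite /P subsetD1 FX xF /=; apply/forallP => a; apply/forallP => b.
  have /forallP/(_ a)/forallP/(_ b) := cX; apply: connect_sub => s t st.
  have [e|ne] := eqVneq [set s; t] [set x; y]; last first.
    by apply: connect1; rewrite /adj in_setD1 ne.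
  by case: (set2_inj e) => -[-> ->] //; rewrite connect_adj_sym.
move/(_ (subD1set _ _)) => XX.
by case/andP: cyc => /andP[xyX _] _; move: xyX; rewrite /adj -XX setD11.
Qed.

End RootedForests.

(** * Rooted forests as cut spanning trees *)

Section Cuts.
Variable V : finType.
Implicit Types (E F T S : {set {set V}}) (W : {set V}) (w : seq V).
Local Open Scope nat_scope.

Definition forests E W : {set {set {set V}}} :=
  [set F : {set {set V}} | (F \subset E) && rooted_forest F W].

(** A component is the set of vertices connected to some [x], so a condition on
    all components amounts to a condition on all vertices. *)
Lemma components_count F w : uniq w ->
  [forall C in components F, count (mem C) w == 1] =
  [forall x, #|[set r in [set z in w] | connect (adj F) x r]| == 1].
Proof.
move=> uw; have cnt x : count (mem [set y in [set: V] | connect (adj F) x y]) w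
    = #|[set r in [set z in w] | connect (adj F) x r]|.
  rewrite -size_filter -(card_uniqP _) ?filter_uniq //; apply: eq_card => y.
  by rewrite mem_filter !inE andbC.
apply/forall_inP/forallP => [w1 x | w1 C /imsetP[x _ ->]]; last by rewrite cnt.
by rewrite -cnt; apply: w1; apply: imset_f; rewrite inE.
Qed.

Lemma cut_forest E T S w : uniq w ->
  T \in spanning_trees E -> S \in cuts T w -> T :\: S \in forests E [set x in w].
Proof.
move=> uw; rewrite !inE => /andP[TE /andP[_ acT]] /and3P[_ _].
rewrite components_count // => cnt.
rewrite /rooted_forest cnt andbT (subset_trans (subsetDl _ _)) //.
exact: sub_acyclic (subsetDl _ _) acT.
Qed.

Lemma tree_rooted_forest T (r : V) : tree T -> rooted_forest T [set r].
Proof.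
case/andP=> /andP[_ /forallP cT] acT; apply/rooted_forestP; split=> // [x|x y].
  by exists r; rewrite ?inE //; apply: forallP (cT x) r.
by rewrite !inE => /eqP-> /eqP->.
Qed.

Lemma card_tree T : simple_graph T -> tree T -> #|T| = #|V|.-1.
Proof.
move=> sT tT; have /andP[/andP[/card_gt0P[r _] _] _] := tT.
by rewrite (card_rooted_forest sT (tree_rooted_forest r tT)) cards1 subn1.
Qed.

(** The cut is what a spanning tree containing [F] has in excess of [F]; its size
    is (n - 1) - (n - l). *)
Lemma forest_cut E F w : simple_graph E -> connected_graph E -> uniq w ->
  0 < size w -> F \in forests E [set x in w] ->
  exists T S, [/\ T \in spanning_trees E, S \in cuts T w & T :\: S = F].
Proof.
move=> sE cE uw w0; rewrite inE => /andP[FE Fw].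
have /andP[acF cnt] := Fw.
have [T Tsp FT] := spanning_tree_extension cE FE acF.
have TSF : T :\: (T :\: F) = F by rewrite setDDr setDv set0U (setIidPr FT).
exists T, (T :\: F); split=> //.
rewrite inE subsetDl TSF components_count // cnt andbT /=.
move: Tsp; rewrite inE => /andP[TE tT].
rewrite cardsD (setIidPr FT) (card_tree (sub_simple TE sE) tT).
rewrite (card_rooted_forest (sub_simple FE sE) Fw).
have szw : #|[set x in w]| = size w by rewrite cardsE; apply/card_uniqP.
have wV : size w <= #|V| by rewrite -szw max_card.
rewrite szw -!subn1 subnAC subKn //.
Qed.

(** Fibring the pairs over the difference [F], each fibre contributes as many equal
    terms as the multiplicity by which they are divided. *)
Lemma sum_trees_cuts (R : numFieldType) E w (omega : {set V} -> R) (a : R) :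
  simple_graph E -> connected_graph E -> uniq w -> 0 < size w ->
  (\sum_(T in spanning_trees E) \sum_(S in cuts T w)
     a / (multiplicity E w T S)%:R * \prod_(e in T :\: S) omega e)%R =
  (a * \sum_(F in forests E [set x in w]) \prod_(e in F) omega e)%R.
Proof.
move=> sE cE uw w0; rewrite pair_big_dep /= mulr_sumr.
rewrite (partition_big (fun p => p.1 :\: p.2) (mem (forests E [set x in w]))) /=; last first.
  by move=> p /andP[]; apply: cut_forest.
apply: eq_bigr => F Ffor.
pose fib := [set p : {set {set V}} * {set {set V}} |
      [&& p.1 \in spanning_trees E, p.2 \in cuts p.1 w & p.1 :\: p.2 == F]].
rewrite (eq_bigr (fun=> a / #|fib|%:R * \prod_(e in F) omega e)%R); last first.
  by move=> p /andP[_ /eqP pF]; rewrite /multiplicity pF.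
rewrite (eq_bigl (fun p => p \in fib)) => [|p]; last by rewrite [RHS]inE -andbA.
rewrite sumr_const -[LHS]mulr_natr mulrAC divfK // Num.Theory.pnatr_eq0 -lt0n card_gt0.
have [T [S [Tsp Scut TSF]]] := forest_cut sE cE uw w0 Ffor.
by apply/set0Pn; exists (T, S); rewrite inE Tsp Scut TSF eqxx.
Qed.

(** Maps and forests are in bijection through [parent_edges]. *)
Lemma sum_parent_maps (R : comNzRingType) E W (omega : {set V} -> R) :
  simple_graph E ->
  (\sum_(f : {ffun V -> option V} |
      [&& grounded f, root_set f == W & parent_edges f \subset E])
      \prod_(e in parent_edges f) omega e)%R =
  (\sum_(F in forests E W) \prod_(e in F) omega e)%R.
Proof.
move=> sE; pose A := [set f : {ffun V -> option V} |
  [&& grounded f, root_set f == W & parent_edges f \subset E]].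
have -> : forests E W = [set parent_edges f | f in A].
  apply/setP => F; rewrite inE; apply/andP/imsetP => [[FE Fw] | [f]].
    have [f [gf rf fF]] := rooted_forest_parent_map (sub_simple FE sE) Fw.
    by exists f; rewrite // inE gf rf fF eqxx.
  rewrite inE => /and3P[gf /eqP <- fE] ->; split=> //.
  exact: parent_edges_rooted_forest.
rewrite big_imset => [|f g] /=; first by apply: eq_bigl => f; rewrite inE.
rewrite !inE => /and3P[gf /eqP rf _] /and3P[gg /eqP rg _].
by apply: parent_edges_inj; rewrite ?rf.
Qed.

End Cuts.

(** * Determinants expanded over parent maps *)

Section ParentMatrix.
Variables (R : idomainType) (n : nat).
Implicit Type f : {ffun 'I_n -> option 'I_n}.

(** The elementary rows are e_i for a root and e_i - e_k for a vertex with
    parent k. *)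
Definition parent_row (i : 'I_n) (o : option 'I_n) (j : 'I_n) : R :=
  (i == j)%:R - (o == Some j)%:R.

Definition parent_mx f : 'M[R]_n := \matrix_(i, j) parent_row i (f i) j.

(** Only the identity contributes: if another permutation [s] mapped every vertex
    that it moves to the parent, a shallowest moved vertex would have a
    shallower image, which is moved as well. *)
Lemma det_parent_mx_grounded f : grounded f -> \det (parent_mx f) = 1.
Proof.
move=> gf; rewrite /determinant (bigD1 (1%g : 'S_n)) //= [X in _ + X]big1 => [|s s1].
  rewrite odd_perm1 expr0 mul1r addr0 big1 // => i _.
  rewrite mxE perm1 /parent_row eqxx; case: eqP => [fi|]; last by rewrite subr0.
  by case: (parent_asym gf fi).
have [i si] : exists i, s i != i.
  apply/existsP; rewrite -negb_forall; apply: contra s1 => /forallP s1.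
  by apply/eqP/permP => i; rewrite perm1; apply/eqP.
case: (arg_minnP (P := fun j => s j != j) (depth f) si) => i0 si0 imin.
have fi0 : f i0 != Some (s i0).
  apply: contraTneq (si0) => /(depth_lt gf) lt_i0.
  have /imin : s (s i0) != s i0 by rewrite (inj_eq perm_inj).
  by rewrite leqNgt lt_i0.
rewrite (bigD1 i0) //= mxE /parent_row eq_sym (negbTE si0) (negbTE fi0).
by rewrite subr0 mul0r mulr0.
Qed.

(** A vertex reaches a root if and only if its parent does, so the indicator of
    the vertices that do not is in the kernel. *)
Lemma det_parent_mx_nongrounded f : ~~ grounded f -> \det (parent_mx f) = 0.
Proof.
rewrite negb_forall => /existsP[x0 x0g]; apply/eqP; rewrite -det_tr; apply/det0P.
pose g x := fconnect (step f) (Some x) None.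
exists (\row_j (~~ g j)%:R).
  apply/eqP => /rowP/(_ x0)/eqP; rewrite !mxE /g x0g oner_eq0 //.
apply/rowP => i; rewrite !mxE.
under eq_bigr => j _ do rewrite !mxE mulrBr.
rewrite sumrB (bigD1 i) //= eqxx mulr1 big1 ?addr0 => [|j /negbTE]; last first.
  by rewrite eq_sym => ->; rewrite mulr0.
apply/eqP; rewrite subr_eq0; apply/eqP; rewrite /g fconnect_step.
case fi: (f i) => [k|]; last first.
  by rewrite connect0 big1 // => j _; rewrite mulr0.
rewrite (bigD1 k) //= eqxx mulr1 big1 ?addr0 // => j jk.
by case: eqP => [[jk']|]; rewrite ?mulr0 // jk' eqxx in jk *.
Qed.

Lemma det_parent_mx f : \det (parent_mx f) = (grounded f)%:R.
Proof.
case gf: (grounded f); first exact: det_parent_mx_grounded.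
by apply: det_parent_mx_nongrounded; rewrite gf.
Qed.

(** Multilinearity of the determinant in its rows. *)
Lemma det_sum_rows (c : 'I_n -> option 'I_n -> R) (A : 'M[R]_n) :
  (forall i j, A i j = \sum_o c i o * parent_row i o j) ->
  \det A = \sum_(f : {ffun 'I_n -> option 'I_n} | grounded f) \prod_i c i (f i).
Proof.
move=> defA; rewrite /determinant.
under eq_bigr => s _.
  under eq_bigr => i _ do rewrite defA.
  rewrite bigA_distr_bigA mulr_sumr.
  under eq_bigr => f _ do rewrite big_split mulrCA.
  over.
rewrite exchange_big [RHS]big_mkcond; apply: eq_bigr => f _ /=.
rewrite -mulr_sumr -[RHS]mulrb -mulr_natr -det_parent_mx; congr (_ * _).
apply: eq_bigr => s _; congr (_ * _).
by apply: eq_bigr => i _; rewrite mxE.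
Qed.

End ParentMatrix.

(** * Increasing tuples as sets *)

Section SubsetsAsTuples.
Local Open Scope nat_scope.

Lemma sorted_enum_ord n (W : {set 'I_n}) :
  sorted (fun a b : 'I_n => a < b) (enum W).
Proof.
have -> : enum W = [seq x <- enum 'I_n | x \in W] by rewrite !enumT.
apply: sorted_filter; first by move=> ? ? ?; apply: ltn_trans.
by rewrite -(@sorted_map _ _ val ltn) val_enum_ord iota_ltn_sorted.
Qed.

Lemma sorted_ord_uniq n (w : seq 'I_n) :
  sorted (fun a b : 'I_n => a < b) w -> uniq w.
Proof.
by apply: sorted_uniq => [a b c|a]; [apply: ltn_trans | apply: ltnn].
Qed.

Lemma enum_sorted_ord n (w : seq 'I_n) :
  sorted (fun a b : 'I_n => a < b) w -> enum [set x in w] = w.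
Proof.
move=> sw; apply: (@irr_sorted_eq _ (fun a b : 'I_n => a < b)) => //.
- by move=> a b c; apply: ltn_trans.
- by move=> a; apply: ltnn.
- exact: sorted_enum_ord.
by move=> x; rewrite mem_enum inE.
Qed.

Lemma sum_sorted_tuples (R : nmodType) n l (G : {set 'I_n} -> R) :
  0 < n ->
  (\sum_(i : l.-tuple 'I_n | sorted (fun a b : 'I_n => (a < b)%N) i)
     G [set x in i])%R = (\sum_(W : {set 'I_n} | #|W| == l) G W)%R.
Proof.
(* The default tuple is only reached by sets of another size than [l]. *)
move=> n0; pose tup (W : {set 'I_n}) : l.-tuple 'I_n :=
  insubd [tuple Ordinal n0 | _ < l] (enum W).
have tupE (W : {set 'I_n}) : #|W| == l -> tup W = enum W :> seq _.
  by move=> cW; rewrite val_insubd -cardE cW.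
rewrite [RHS](reindex_onto (fun i : l.-tuple 'I_n => [set x in i]) tup).
  apply: eq_bigl => i; apply/idP/andP => [si | [ci /eqP <-]].
    have ci : #|[set x in i]| == l.
      by rewrite cardsE (card_uniqP (sorted_ord_uniq si)) size_tuple.
    by split=> //; apply/eqP/val_inj; rewrite /= tupE // enum_sorted_ord.
  by rewrite tupE ?sorted_enum_ord.
by move=> W cW; apply/setP => x; rewrite inE memtE tupE // mem_enum.
Qed.

End SubsetsAsTuples.

(** * The Laplacian with a potential *)

Lemma sum_option (R : nmodType) (I : finType) (F : option I -> R) :
  \sum_o F o = F None + \sum_i F (Some i).
Proof.
rewrite (bigD1 None) //=; congr (_ + _).
rewrite (reindex_omap Some id) /= => [|[]] //.
by apply: eq_bigl => i; rewrite eqxx.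
Qed.

Section Laplacian.
Variables (R : idomainType) (n : nat) (E : {set {set 'I_n}}).
Variables (omega : {set 'I_n} -> R) (delta : 'I_n -> R).

(** Giving weight 0 to a parent that is not a neighbour lets the expansion range
    over all parent maps, those that leave the graph contributing nothing. *)
Definition parent_weight (i : 'I_n) (o : option 'I_n) : R :=
  if o is Some k then if adj E i k then omega [set i; k] else 0 else delta i.

Lemma laplacian_rows i j : simple_graph E ->
  (laplacian E omega + diag_mx (\row_i delta i)) i j =
  \sum_o parent_weight i o * parent_row R i o j.
Proof.
move=> sE; rewrite !mxE sum_option /parent_row /= subr0 mulr_natr addrC.
congr (_ + _).
under [RHS]eq_bigr => k _ do rewrite mulrBr.
rewrite sumrB -mulr_suml [X in _ - X](bigD1 j) //= eqxx mulr1.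
rewrite [X in _ - (_ + X)]big1 ?addr0 => [|k /negbTE kj]; last first.
  by rewrite (inj_eq Some_inj) kj mulr0.
rewrite -big_mkcond /=; have [<-|ij] := eqVneq i j.
  by rewrite mulr1 adj_irrefl // subr0.
by rewrite mulr0 sub0r; case: ifP; rewrite ?oppr0.
Qed.

Lemma prod_parent_weight (f : {ffun 'I_n -> option 'I_n}) : grounded f ->
  \prod_i parent_weight i (f i) =
  if parent_edges f \subset E then
    \prod_(i in root_set f) delta i * \prod_(e in parent_edges f) omega e else 0.
Proof.
move=> gf; case: ifPn => [/subsetP fE|/subsetPn[e /imsetP[i]]]; last first.
  rewrite in_setC mem_root_set; case fi: (f i) => [j|] //= _ -> /negbTE ijE.
  by rewrite (bigD1 i) //= fi /= /adj ijE mul0r.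
rewrite (bigID (mem (root_set f))) /=; congr (_ * _).
  by apply: eq_bigr => i; rewrite mem_root_set => /eqP->.
rewrite big_imset; last exact: parent_edge_inj.
apply: eq_big => i; rewrite ?in_setC // mem_root_set.
case fi: (f i) => [j|] //= _; rewrite ifT //.
by apply: fE; apply: parent_edge.
Qed.

Lemma det_laplacian_forests : simple_graph E ->
  \det (laplacian E omega + diag_mx (\row_i delta i)) =
  \sum_(W : {set 'I_n})
    (\prod_(i in W) delta i) * \sum_(F in forests E W) \prod_(e in F) omega e.
Proof.
move=> sE; rewrite (det_sum_rows (c := parent_weight)); last first.
  by move=> i j; apply: laplacian_rows.
rewrite (partition_big (@root_set _) predT) //; apply: eq_bigr => W _.
rewrite -(sum_parent_maps W omega sE) mulr_sumr.
rewrite [RHS](eq_bigl (fun f => (grounded f && (root_set f == W))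
    && (parent_edges f \subset E))); last by move=> f; rewrite andbA.
rewrite [RHS]big_mkcondr; apply: eq_bigr => f /andP[gf /eqP <-].
exact: prod_parent_weight.
Qed.

End Laplacian.

Theorem theorem6p1 (R : realFieldType) (n : nat) (E : {set {set 'I_n}})
    (omega : {set 'I_n} -> R) (delta : 'I_n -> R)
    (simpleE : simple_graph E) (connE : connected_graph E) :
  \det (laplacian E omega + diag_mx (\row_i delta i)) =
  \sum_(T in spanning_trees E)
    \sum_(1 <= l < n.+1)
      \sum_(i : l.-tuple 'I_n | sorted (fun a b : 'I_n => (a < b)%N) i)
        \sum_(S in cuts T i)
          (\prod_(j < l) delta (tnth i j)) / (multiplicity E i T S)%:R
            * \prod_(e in T :\: S) omega e.
Proof.
have n0 : (0 < n)%N by case/andP: connE; rewrite card_ord.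
rewrite det_laplacian_forests // exchange_big /=.
pose G (W : {set 'I_n}) :=
  (\prod_(i in W) delta i) * \sum_(F in forests E W) \prod_(e in F) omega e.
rewrite [RHS](eq_big_nat _ _ (F2 := fun l => \sum_(W : {set 'I_n} | #|W| == l) G W)).
  have cardW (W : {set 'I_n}) : (#|W| < n.+1)%N by have := max_card W; rewrite card_ord.
  rewrite (partition_big (fun W => Ordinal (cardW W)) predT) //=.
  rewrite -(big_mkord predT (fun l => \sum_(W : {set 'I_n} | #|W| == l) G W)).
  (* The empty set of roots contributes nothing, as there is a vertex. *)
  rewrite [LHS]big_ltn // [X in X + _]big1 ?add0r // => W; rewrite cards_eq0 => /eqP->.
  rewrite /G [X in _ * X]big1 ?mulr0 // => F.
  rewrite inE => /andP[_ /rooted_forestP[_ reach _]].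
  by have [r] := reach (Ordinal n0); rewrite inE.
move=> l /andP[l0 _]; rewrite -sum_sorted_tuples // exchange_big /=.
apply: eq_bigr => i si; have ui := sorted_ord_uniq si.
rewrite sum_trees_cuts ?size_tuple // /G; congr (_ * _).
rewrite -(big_tuple _ _ i predT delta) big_uniq //=.
by apply: eq_bigl => x; rewrite inE.
Qed.
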